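(* Let $t$ be a positive integer and $G$ a flower group of type $(c_0;c_1,\ldots,c_k)$. For $0\le i\le k$ write $c_i=\nu_i\omega_i$ where $\omega_i$ is the greatest divisor of $c_i$ relatively prime to $t$. Then the functional graph $\mathcal G(\varphi_t/G)$ of $\varphi_t:G\to G$, $g\mapsto g^t$, is isomorphic to $$\left(\bigoplus_{i=1}^k\bigoplus_{d_i\mid\omega_i,\ d_i\nmid\omega_0}\frac{\varphi(d_i)}{\operatorname{ord}_{d_i}(t)}\times\operatorname{Cyc}\left(\operatorname{ord}_{d_i}(t),T_{\gcd_t(\nu_i)}\right)\right)\oplus\left(\bigoplus_{d_0\mid\omega_0}\frac{\varphi(d_0)}{\operatorname{ord}_{d_0}(t)}\times\operatorname{Cyc}\left(\operatorname{ord}_{d_0}(t),\mathcal T_t(G)\right)\right),$$ where the central tree $\mathcal T_t(G)$ has $\sum_{i=1}^k\nu_i-(k-1)\nu_0$ vertices.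
   Context: A cyclic subgroup of a group is a $\mu$-subgroup if it is not contained in any cyclic subgroup other than itself. A finite noncyclic group $G$, whose set of $\mu$-subgroups is $\{C_1,\ldots,C_k\}$, is a flower group if there is a subgroup $C_0$ with $C_i\cap C_j=C_0$ for all $1\le i<j\le k$; $C_0$ is the pistil, $C_1,\ldots,C_k$ the petals, and $(c_0;c_1,\ldots,c_k)$ with $c_i=|C_i|$ the type. $\mathcal G(\varphi_t/G)$ is the digraph with vertex set $G$ and edges $g\to g^t$; for a periodic vertex $v$ the rooted tree attached to $v$ consists of all $u$ whose forward orbit first meets the periodic elements at $v$, with edges $u\to u^t$ for $u\ne v$. The central tree $\mathcal T_t(G)$ is the tree attached to the identity. $\varphi$ is Euler's totient, $\operatorname{ord}_d(t)$ the multiplicative order of $t$ mod $d$ ($\operatorname{ord}_1(t)=1$). Rooted trees have edges toward the root; $\bullet$ is the one-vertex tree; $\operatorname{Cyc}(m,T)$ is a directed $m$-cycle each of whose vertices is the root of a copy of $T$; $\oplus$ is disjoint union, $m\times H$ is $m$ disjoint copies of $H$; for a forest $F=\bigoplus T_i$, $\langle F\rangle$ is the tree whose root has children that are roots of copies of the $T_i$, $\langle\emptyset\rangle=\bullet$. Iterated gcd: $\gcd_t(n)=(1)$ if $\gcd(t,n)=1$; otherwise $(\nu_1,\ldots,\nu_D)$ with $\nu_1=\gcd(t,n)$, $\nu_{i+1}=\gcd(t,n/(\nu_1\cdots\nu_i))$, $D$ least with $\nu_{D+1}=1$. Elementary tree of a non-increasing sequence $\mathbf v=(\nu_1,\ldots,\nu_d)$: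 $T^0_{\mathbf v}=\bullet$; for $1\le k<d$, $T^k_{\mathbf v}=\langle\nu_k\times T^{k-1}_{\mathbf v}\oplus\bigoplus_{i=1}^{k-1}(\nu_i-\nu_{i+1})\times T^{i-1}_{\mathbf v}\rangle$; $T_{\mathbf v}=\langle(\nu_d-1)\times T^{d-1}_{\mathbf v}\oplus\bigoplus_{i=1}^{d-1}(\nu_i-\nu_{i+1})\times T^{i-1}_{\mathbf v}\rangle$. *)

(* Defs.v *)
From HB Require Import structures.
From mathcomp Require Import all_boot all_fingroup all_solvable.

Set Implicit Arguments.
Unset Strict Implicit.
Unset Printing Implicit Defensive.

Record digraph := Digraph { vert :> finType; edge : rel vert }.

Definition digraph_iso (H K : digraph) : Prop :=
  exists2 f : H -> K, bijective f & forall x y, edge (f x) (f y) = edge x y.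

Definition dempty : digraph := @Digraph void (fun _ _ => false).

Definition dsum (H K : digraph) : digraph :=
  @Digraph (H + K)%type (fun u v =>
    match u, v with
    | inl x, inl y => edge x y
    | inr x, inr y => edge x y
    | _, _ => false
    end).

Definition dcopies (m : nat) (H : digraph) : digraph := iter m (dsum H) dempty.

(* Only the root is recorded; all the rooted digraphs built below are trees,
   and their root has no outgoing edge. *)
Record rtree := RTree { tgraph :> digraph; troot : tgraph }.

Definition bullet : rtree := @RTree (@Digraph unit (fun _ _ => false)) tt.

(* [graft T S] makes the root of [T] a new child of the root of [S]. *)
Definition graft (T S : rtree) : rtree :=
  @RTree
    (@Digraph (T + S)%type (fun u v =>
       match u, v with
       | inl x, inl y => edge x y
       | inr x, inr y => edge x y
       | inl x, inr y => (x == troot T) && (y == troot S)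
       | inr _, inl _ => false
       end))
    (inr (troot S)).

(* A forest is the list of its trees, so that the disjoint union of forests is
   [++] and m copies of T form the forest [nseq m T]. *)
Definition rjoin (F : seq rtree) : rtree := foldr graft bullet F.

Definition Cyc (m : nat) (T : rtree) : digraph :=
  @Digraph ('I_m * T)%type (fun u v =>
    ((u.1 == v.1) && edge u.2 v.2)
    || [&& u.2 == troot T, v.2 == troot T & v.1 == ordS u.1]).

Section FunctionalGraph.
Variables (V : finType) (f : V -> V).

Definition functional_graph : digraph := @Digraph V (fun x y => f x == y).

Definition periodic (v : V) : bool := fconnect f (f v) v.

(* The first periodic element of the forward orbit u, f u, f (f u), ...; the
   default value is never used, see [periodic_entry]. *)
Definition entry (u : V) : V :=
  head u [seq x <- fingraph.orbit f u | periodic x].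

Lemma entry_periodic v : periodic v -> entry v == v.
Proof. by rewrite /entry /fingraph.orbit -orderSpred /= => ->. Qed.

Lemma periodic_entry u : periodic (entry u).
Proof.
rewrite /entry.
have [x xu px] : exists2 x, x \in fingraph.orbit f u & periodic x.
  have /trajectP [i lti eqi] : looping f u (fingraph.order f u).
    exact: looping_order.
  exists (iter i f u).
    by rewrite -fconnect_orbit fconnect_iter.
  rewrite /periodic -[X in fconnect _ _ X]eqi.
  have -> : fingraph.order f u = (fingraph.order f u - i.+1) + i.+1.
    by rewrite subnK.
  by rewrite iterD iterS fconnect_iter.
have : x \in [seq x <- fingraph.orbit f u | periodic x].
  by rewrite mem_filter px.
case E: [seq x <- _ | _] => [//|y s] _ /=.
have : y \in y :: s by rewrite inE eqxx.
by rewrite -E mem_filter => /andP[].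
Qed.

Definition attached_tree (v : V) (pv : periodic v) : rtree :=
  @RTree
    (@Digraph {u : V | entry u == v}
       (fun x y => (val x != v) && (f (val x) == val y)))
    (exist _ v (entry_periodic pv)).

End FunctionalGraph.

(* The least n > 0 with t ^ n = 1 mod d; as ord_d(t) <= totient d <= d when t
   and d are coprime, the search may stop at d. *)
Definition mulord (d t : nat) : nat :=
  (find (fun n => t ^ n.+1 == 1 %[mod d]) (iota 0 d)).+1.

Lemma mulordP (d t : nat) : 0 < d -> coprime t d ->
  t ^ mulord d t = 1 %[mod d] /\
  forall n, 0 < n < mulord d t -> t ^ n <> 1 %[mod d].
Proof.
move=> d_gt0 co_td; rewrite /mulord.
set p := fun n => t ^ n.+1 == 1 %[mod d].
have hp : has p (iota 0 d).
  apply/hasP; exists (totient d).-1.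
    rewrite mem_iota add0n leq0n /=.
    apply: leq_trans (_ : totient d <= d); first by rewrite ltn_predL totient_gt0.
    rewrite totient_count_coprime.
    apply: (@leq_trans (\sum_(0 <= i < d) 1)); last first.
      by rewrite sum_nat_const_nat subn0 muln1.
    by apply: leq_sum => i _; case: coprime.
  by rewrite /p prednK ?totient_gt0 //; apply/eqP; exact: Euler_exp_totient.
split.
  have := nth_find 0 hp; rewrite nth_iota; last by rewrite -[X in _ < X](size_iota 0) -has_find.
  by rewrite add0n => /eqP.
case=> // n /=; rewrite ltnS => lt_n.
have := before_find 0 lt_n; rewrite nth_iota ?add0n; first by move/eqP.
by apply: leq_trans lt_n _; rewrite -[X in _ <= X](size_iota 0) find_size.
Qed.

Definition omega_part (t c : nat) : nat := \max_(d <- divisors c | coprime d t) d.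
Definition nu_part (t c : nat) : nat := c %/ omega_part t c.

(* [fuel] bounds the number of terms; n is enough for n > 0, since each term
   divides what remains of n by at least 2. *)
Fixpoint iter_gcd_rec (fuel t n : nat) : seq nat :=
  if fuel is fuel'.+1 then
    if coprime t n then [::]
    else gcdn t n :: iter_gcd_rec fuel' t (n %/ gcdn t n)
  else [::].

Definition iter_gcd (t n : nat) : seq nat :=
  if coprime t n then [:: 1] else iter_gcd_rec n t n.

Section ElementaryTree.
Variable v : seq nat.

(* 1-based indexing: [elt 1, ..., elt (size v)] are the entries of v. *)
Let elt (i : nat) : nat := nth 0 v i.-1.

(* The list T^0, ..., T^k; the recursion is unfolded in [elem_levelS]. *)
Fixpoint elem_levels (k : nat) : seq rtree :=
  if k is k'.+1 then
    let s := elem_levels k' in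
    rcons s (rjoin (nseq (elt k) (nth bullet s k') ++
      \big[cat/[::]]_(1 <= i < k) nseq (elt i - elt i.+1) (nth bullet s i.-1)))
  else [:: bullet].

Definition elem_level (k : nat) : rtree := nth bullet (elem_levels k) k.

Definition elem_tree : rtree :=
  let d := size v in
  rjoin (nseq (elt d - 1) (elem_level d.-1) ++
    \big[cat/[::]]_(1 <= i < d) nseq (elt i - elt i.+1) (elem_level i.-1)).

Lemma size_elem_levels k : size (elem_levels k) = k.+1.
Proof. by elim: k => //= k IHk; rewrite size_rcons IHk. Qed.

Lemma nth_elem_levels k i :
  i <= k -> nth bullet (elem_levels k) i = elem_level i.
Proof.
elim: k => [|k IHk]; first by rewrite leqn0 => /eqP ->.
rewrite leq_eqVlt => /orP[/eqP -> //|lt_ik].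
by rewrite /= nth_rcons size_elem_levels lt_ik IHk.
Qed.

Lemma elem_level0 : elem_level 0 = bullet.
Proof. by []. Qed.

Lemma elem_levelS k : 0 < k ->
  elem_level k = rjoin (nseq (elt k) (elem_level k.-1) ++
    \big[cat/[::]]_(1 <= i < k) nseq (elt i - elt i.+1) (elem_level i.-1)).
Proof.
case: k => // k _; rewrite {1}/elem_level /= nth_rcons size_elem_levels ltnn eqxx.
rewrite nth_elem_levels //; congr (rjoin (_ ++ _)).
apply: eq_big_nat => i /andP[i_gt0 lt_ik].
by rewrite nth_elem_levels // -ltnS prednK // ltnW.
Qed.

End ElementaryTree.

Section Groups.
Variable gT : finGroupType.
Implicit Types G C : {group gT}.

Definition mu_subgroup G C : bool :=
  [max C of D | (D \subset G) && cyclic D]%g.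

Definition flower G (k : nat) (C0 : {group gT}) (C : 'I_k -> {group gT}) : Prop :=
  [/\ ~~ cyclic G,
      injective C,
      forall D : {group gT}, mu_subgroup G D <-> exists i, C i = D
    & forall i j : 'I_k, i < j -> C i :&: C j = C0].

Definition flower_of_type G (k c0 : nat) (c : 'I_k -> nat) : Prop :=
  exists (C0 : {group gT}) (C : 'I_k -> {group gT}),
    [/\ flower G C0 C, c0 = #|C0| & forall i, c i = #|C i|].

Definition power_map (t : nat) G : subg_of G -> subg_of G := fun g => (g ^+ t)%g.

Definition power_graph (t : nat) G : digraph := functional_graph (@power_map t G).

Lemma periodic_power_map1 (t : nat) G : periodic (@power_map t G) 1%g.
Proof. by rewrite /periodic /power_map expg1n connect0. Qed.

Definition central_tree (t : nat) G : rtree :=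
  attached_tree (periodic_power_map1 t G).

End Groups.

(* Main.v *)
Require Import Defs.
From mathcomp Require Import all_boot all_fingroup all_solvable.
From mathcomp Require Import zify.

Set Implicit Arguments.
Unset Strict Implicit.
Unset Printing Implicit Defensive.

(* An element is periodic iff its order is coprime to t, and the component of a
   periodic v is determined by its cycle, of length ord_d(t) with d = #[v], and
   by the trees attached along it. If v lies in a single petal C, so does its
   tree; there x |-> x ^ t maps the i-th iterated image of C onto the next one
   with fibres of size gcd(t, n_i), n_i being the order of the i-th image, so
   the isomorphism type of the subtree at a non-periodic x depends only on the
   largest i with x in the i-th image, which is the recursion defining the
   elementary trees. If v lies in the pistil, it is central, and multiplication
   of the elements of depth j by the t^j-th root of v in <[v]> carries the
   central tree to the tree at v. *)

(** * Trees in functional graphs *)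

Section Trees.
Variables (V : finType) (f : V -> V).
Implicit Types (u v x y : V) (T : rtree).

Lemma periodicP x : reflect (exists n, iter n.+1 f x = x) (periodic f x).
Proof.
apply: (iffP idP) => [cx | [n e]].
  by exists (findex f (f x) x); rewrite iterSr iter_findex.
by rewrite /periodic -[X in fconnect _ _ X]e iterSr fconnect_iter.
Qed.

Lemma periodic_step x : periodic f x -> periodic f (f x).
Proof.
by move=> /periodicP[n e]; apply/periodicP; exists n; rewrite -iterSr iterS e.
Qed.

Lemma periodic_iter n x : periodic f x -> periodic f (iter n f x).
Proof. by move=> px; elim: n => //= n /periodic_step. Qed.

(** Number of steps from [u] to its first periodic iterate; by [depth_lt_order] the search never
    runs off the end of the orbit. *)
Definition depth u := find (periodic f) (fingraph.orbit f u).

Lemma depth_lt_order u : depth u < fingraph.order f u.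
Proof.
rewrite -[X in _ < X](size_traject f u) -has_find.
case: (boolP (has _ _)) => //= /hasPn np.
have uo : u \in traject f u (fingraph.order f u).
  by rewrite -orderSpred /= inE eqxx.
(* Without a periodic point in the orbit, [entry] would return its default [u], which
   [periodic_entry] makes periodic. *)
have := periodic_entry f u; rewrite /entry.
have -> : [seq x <- fingraph.orbit f u | periodic f x] = [::].
  by apply/eqP; rewrite -[_ == _]negbK -has_filter; apply/hasPn.
by move=> /= pu; have := np u uo; rewrite pu.
Qed.

Lemma iter_depth u : iter (depth u) f u = entry f u.
Proof.
have hE (s : seq V) (a : pred V) : head u (filter a s) = nth u s (find a s).
  by elim: s => //= x s IHs; case: ifP.
by rewrite /entry hE nth_traject // depth_lt_order.
Qed.

Lemma lt_depth u i : i < depth u -> ~~ periodic f (iter i f u).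
Proof.
move=> lt_i; have := before_find u lt_i.
by rewrite nth_traject => [->|] //; apply: ltn_trans lt_i (depth_lt_order u).
Qed.

Lemma depth_eq u j : periodic f (iter j f u) ->
  (forall i, i < j -> ~~ periodic f (iter i f u)) -> depth u = j.
Proof.
move=> pj nj; case: (ltngtP (depth u) j) => // [/nj|/lt_depth].
  by rewrite iter_depth periodic_entry.
by rewrite pj.
Qed.

Lemma depth_periodic u : (depth u == 0) = periodic f u.
Proof.
apply/eqP/idP => [d0|pu]; last exact: depth_eq.
by have := periodic_entry f u; rewrite -iter_depth d0.
Qed.

Lemma depth_step u : ~~ periodic f u -> depth u = (depth (f u)).+1.
Proof.
move=> nu; apply: depth_eq => [|[|i] //=]; rewrite -?iterS iterSr.
  by rewrite iter_depth periodic_entry.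
by rewrite ltnS; apply: lt_depth.
Qed.

Lemma entry_step u : ~~ periodic f u -> entry f (f u) = entry f u.
Proof. by move=> nu; rewrite -!iter_depth (depth_step nu) iterSr. Qed.

(* For a periodic [x] these are the vertices of the attached tree of [x], for
   any other [x] those of the subtree rooted at [x]. *)
Definition above x u :=
  exists2 j, iter j f u = x & forall i, i < j -> ~~ periodic f (iter i f u).

Lemma above_refl x : above x x.
Proof. by exists 0. Qed.

Lemma above_stepP x u :
  above x u <-> u = x \/ ~~ periodic f u /\ above x (f u).
Proof.
split=> [[[|j] /= e nj] | [-> | [nu [j e nj]]]]; first by left.
- right; split; first exact: (nj 0).
  by exists j; rewrite -?iterSr // => i lt_ij; rewrite -iterSr nj.
- exact: above_refl.
exists j.+1; first by rewrite iterSr.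
by case=> //= i lt_ij; rewrite -iterS iterSr nj.
Qed.

(** While [above_stepP] splits off the first step of the path from [u], here the last step, into
    [x], is split off: a tree decomposes at its root into the subtrees at the children. *)
Lemma above_childP x u : above x u <->
  u = x \/ exists y, [/\ f y = x, ~~ periodic f y & above y u].
Proof.
split=> [[[|j] /= e nj] | [-> | [y [fy ny [j e nj]]]]]; first by left.
- right; exists (iter j f u); split=> //; first exact: nj.
  by exists j => // i lt_ij; rewrite nj // ltnW.
- exact: above_refl.
exists j.+1; first by rewrite /= e.
move=> i; rewrite ltnS leq_eqVlt => /orP[/eqP-> | /nj //].
by rewrite e.
Qed.

Lemma above_step x u : u != x -> above x u -> above x (f u).
Proof. by move=> /eqP nux /above_stepP[|[]]. Qed.

Lemma above_nonperiodic x u : u != x -> above x u -> ~~ periodic f u.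
Proof. by move=> /eqP nux /above_stepP[|[]]. Qed.

Lemma child_not_above y : ~~ periodic f y -> ~ above y (f y).
Proof. by move=> /negP ny [j e _]; apply/ny/periodicP; exists j; rewrite iterSr. Qed.

(** The longer of two paths from [u] passes through the end of the shorter. If the lengths differed,
    the orbit of the common image would return to one of the two ends, which would be periodic. *)
Lemma above_child_inj y1 y2 u : ~~ periodic f y1 -> ~~ periodic f y2 ->
  f y1 = f y2 -> above y1 u -> above y2 u -> y1 = y2.
Proof.
move=> n1 n2 e12 [j1 e1 _] [j2 e2 _].
wlog le12: y1 y2 j1 j2 n1 n2 e12 e1 e2 / j1 <= j2.
  move=> IH; case: (leqP j1 j2) => [|/ltnW] le12; first exact: IH le12.
  by apply/esym/(IH y2 y1 j2 j1).
move: le12 e2; rewrite leq_eqVlt => /orP[/eqP<- | lt12]; first by rewrite e1.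
rewrite -(subnK lt12) addnS -addSn iterD e1 iterSr e12 => e2.
by case/periodicP: n2; exists (j2 - j1.+1); rewrite iterSr.
Qed.

Lemma above_entryP v u : periodic f v -> above v u <-> entry f u = v.
Proof.
move=> pv; split=> [[j e nj] | <-].
  by rewrite -iter_depth (@depth_eq u j) ?e.
by exists (depth u); [exact: iter_depth | exact: lt_depth].
Qed.

(** The factor [a != troot T] drops the edge that leaves [x] itself. *)
Definition tree_at x T := exists g : T -> V,
  [/\ injective g, g (troot T) = x,
      forall a b, edge a b = (a != troot T) && (f (g a) == g b)
    & forall u, (exists a, g a = u) <-> above x u].

(** Stated for any list of children of [x], so that induction can graft one subtree at a time. *)
Lemma rjoin_at x (T : V -> rtree) ys : uniq ys ->
  (forall y, y \in ys -> [/\ f y = x, ~~ periodic f y & tree_at y (T y)]) ->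
  exists g : rjoin (map T ys) -> V,
    [/\ injective g, g (troot (rjoin (map T ys))) = x,
        forall a b, edge a b = (a != troot (rjoin (map T ys))) && (f (g a) == g b)
      & forall u, (exists a, g a = u) <-> u = x \/ exists2 y, y \in ys & above y u].
Proof.
elim: ys => [|y ys IHys] /=.
  move=> _ _; exists (fun _ => x); split=> //; first by move=> [] [].
  by move=> u; split=> [[_ <-] | [-> | [y]]]; [left | exists tt | ].
case/andP=> y_ys u_ys ysP.
have [y' in_y'|g [g_inj g_root g_edge g_img]] := IHys u_ys.
  by apply: ysP; rewrite inE in_y' orbT.
have [fy ny [h [h_inj h_root h_edge h_img]]] := ysP y (mem_head _ _).
set S := rjoin (map T ys) in g g_inj g_root g_edge g_img *.
have xy : ~ above y x by rewrite -fy; apply: child_not_above.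
have hy a : above y (h a) by apply/h_img; exists a.
have disj y' u : y' \in ys -> above y u -> above y' u -> False.
  move=> in_y' a1 a2; move/negP: y_ys; apply.
  have [|fy' ny' _] := ysP y'; first by rewrite inE in_y' orbT.
  by rewrite (@above_child_inj y y' u) // fy fy'.
have gP b : g b = x \/ exists2 y', y' \in ys & above y' (g b).
  by apply/g_img; exists b.
have gNy b : ~ above y (g b).
  by case: (gP b) => [->//|[y' /disj d a2 a1]]; exact: d a1 a2.
exists (fun c : T y + S => match c with inl a => h a | inr b => g b end).
split=> //.
- move=> [a|a] [b|b] /= e; [by rewrite (h_inj _ _ e) | | | by rewrite (g_inj _ _ e)].
    by case: (gNy b); rewrite -e.
  by case: (gNy a); rewrite e.
- case=> [a|a] [b|b] /=.
  + rewrite h_edge; have [->|//] := eqVneq a (troot (T y)).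
    rewrite h_root fy /=; apply/esym/negP => /eqP e; apply: xy; rewrite e; exact: hy.
  + have [->|ar] /= := eqVneq a (troot (T y)).
      by rewrite h_root fy -g_root (inj_eq g_inj) eq_sym.
    apply/esym/negP => /eqP e; apply: (gNy b); rewrite -e; apply: above_step => //.
    by rewrite -h_root (inj_eq h_inj).
  + apply/esym/negP => /andP[ar /eqP e].
    have ha := hy b; rewrite -e in ha.
    have ax : g a <> x by move=> ga; case/eqP: ar; congr inr; apply: g_inj; rewrite ga.
    (* A vertex over another child either is that child, with image [x], or has its image over that
       child too; neither image lies above [y]. *)
    case: (gP a) => [//|[y' in_y' /above_stepP[e'|[_ a']]]].
      have [|fy' _ _] := ysP y'; first by rewrite inE in_y' orbT.
      by apply: xy; rewrite -fy' -e'.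
    exact: disj a'.
  + exact: g_edge.
move=> u; split.
  case=> [[a|b]] <-; first by right; exists y; rewrite ?mem_head.
  case: (gP b) => [->|[y' in_y' a']]; [by left | right].
  by exists y'; rewrite // inE in_y' orbT.
case=> [->|[y']]; first by exists (inr (troot S)).
rewrite inE => /orP[/eqP-> /h_img[a <-]| in_y' a']; first by exists (inl a).
by have [b <-] : exists a, g a = u; [apply/g_img; right; exists y' | exists (inr b)].
Qed.

Lemma rjoin_tree_at x (T : V -> rtree) ys : uniq ys ->
  (forall y, (y \in ys) = (f y == x) && ~~ periodic f y) ->
  (forall y, y \in ys -> tree_at y (T y)) ->
  tree_at x (rjoin (map T ys)).
Proof.
move=> u_ys ysE ysT.
have [y in_y|g [g_inj g_root g_edge g_img]] := @rjoin_at x T ys u_ys.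
  by have := in_y; rewrite ysE => /andP[/eqP-> ->]; split=> //; apply: ysT.
exists g; split=> // u; rewrite g_img above_childP.
split=> -[|[y]]; try by left.
  by rewrite ysE => /andP[/eqP fy ny] au; right; exists y.
by case=> fy ny au; right; exists y; rewrite // ysE fy eqxx.
Qed.

End Trees.

(** * Elementary trees *)

(** Lets the children of a vertex be listed in the order in which the recursion lists their trees,
    so that the two forests agree as lists. *)
Lemma perm_map_lift (A B : eqType) (h : A -> B) (s : seq A) (r : seq B) :
  perm_eq r (map h s) -> exists2 s', perm_eq s' s & map h s' = r.
Proof.
case: s => [/perm_nilP-> | x0 s]; first by exists [::].
set s0 := x0 :: s => pr.
have [I pI ->] := perm_iotaP (h x0) pr.
rewrite size_map in pI.
exists (map (nth x0 s0) I).
  by rewrite -[X in perm_eq _ X](mkseq_nth x0) /mkseq perm_map.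
rewrite -map_comp; apply/eq_in_map => i; rewrite (perm_mem pI) mem_iota => /andP[_ lt_i].
by rewrite [RHS](nth_map x0).
Qed.

Section LevelSeq.
Variables (c : nat -> nat) (a k : nat).

(** Indices of the trees in the recursion at stage [k], in the order of its forest; [a] is the
    multiplicity of the top index [k - 1]. *)
Definition level_seq : seq nat :=
  nseq a k.-1 ++ \big[cat/[::]]_(1 <= i < k) nseq (c i - c i.+1) i.-1.

Lemma map_level_seq (T : nat -> rtree) : map T level_seq =
  nseq a (T k.-1) ++ \big[cat/[::]]_(1 <= i < k) nseq (c i - c i.+1) (T i.-1).
Proof.
rewrite map_cat map_nseq (big_morph (map T) (@map_cat _ _ T) (erefl _)).
by congr (_ ++ _); apply: eq_bigr => i _; rewrite map_nseq.
Qed.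

Lemma count_level_seq j : count_mem j level_seq =
  if j < k.-1 then c j.+1 - c j.+2 else if j == k.-1 then a else 0.
Proof.
rewrite /level_seq count_cat (big_morph (count_mem j) (@count_cat _ _) (erefl _)).
rewrite count_nseq big_add1 /=; set m := k.-1.
under eq_bigr => i _ do rewrite count_nseq /=.
have -> : \sum_(0 <= i < m) (i == j) * (c i.+1 - c i.+2)
    = if j < m then c j.+1 - c j.+2 else 0.
  elim: m => [|m IHm]; first by rewrite big_geq.
  rewrite big_nat_recr //= IHm ltnS; case: (ltngtP j m) => [||->] //=.
  - by rewrite addn0.
  - by rewrite mul1n.
by rewrite eq_sym; case: (ltngtP j m) => _ //=; rewrite ?mul1n ?addn0.
Qed.

End LevelSeq.

(** Abstract form of a petal: [H i] stands for its i-th iterated image under [f], and from index [d]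
    on all points are periodic. *)
Section ElementaryTrees.
Variables (V : finType) (f : V -> V) (nu : seq nat) (H : nat -> {set V}).
Let d := size nu.
Let elt i := nth 0 nu i.-1.
Hypothesis d_gt0 : 0 < d.
Hypothesis H_step : forall i x, x \in H i -> f x \in H i.+1.
Hypothesis H_sub : forall i, H i.+1 \subset H i.
(** The default 1 of [nth] matters at [i = d], where fibres have a single point. *)
Hypothesis H_card : forall i x, i <= d -> x \in H i.+1 ->
  #|[set y in H i | f y == x]| = nth 1 nu i.
Hypothesis H_periodic : forall i x, x \in H 0 -> periodic f x -> x \in H i.
Hypothesis Hd_periodic : forall x, x \in H d -> periodic f x.

Let subH i j : i <= j -> H j \subset H i.
Proof.
elim: j => [|j IHj]; first by rewrite leqn0 => /eqP->.
rewrite leq_eqVlt => /orP[/eqP-> // | /IHj]; exact: subset_trans.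
Qed.

(** For [x] in [H 0], the largest [i] at most [d] with [x] in [H i]; a failed search returns [d]. *)
Definition level x := find (fun i => x \notin H i.+1) (iota 0 d).

Lemma level_le x : level x <= d.
Proof. by rewrite /level -[X in _ <= X](size_iota 0) find_size. Qed.

Lemma levelP x i : x \in H 0 -> i <= d -> (x \in H i) = (i <= level x).
Proof.
move=> x0; case: i => // i lt_id; apply/idP/idP => [xi | lt_i].
  rewrite ltnNge; apply/negP => le_l.
  have lt_l : level x < d by apply: leq_ltn_trans lt_id.
  have h : has (fun i => x \notin H i.+1) (iota 0 d) by rewrite has_find size_iota.
  have := nth_find 0 h; rewrite nth_iota // add0n => /negP; apply.
  by apply: (subsetP (subH _)) xi.
by have := before_find 0 lt_i; rewrite nth_iota // add0n => /negbFE.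
Qed.

Lemma nonperiodic_level_lt x : x \in H 0 -> ~~ periodic f x -> level x < d.
Proof.
move=> x0 nx; rewrite ltnNge; apply: contra nx => le_d.
by apply: Hd_periodic; rewrite levelP.
Qed.

Let children x := [seq y <- enum V | (f y == x) && ~~ periodic f y].
Let P x j := [set y in H j | f y == x].

Lemma card_no_preimage x j : x \notin H j.+1 -> #|P x j| = 0.
Proof.
move=> xj; apply/eqP; rewrite cards_eq0; apply/eqP/setP => y; rewrite !inE.
by apply/negP => /andP[/H_step yj /eqP fy]; move: xj; rewrite -fy yj.
Qed.

(** A child of level [j < d] is a preimage in [H j] but not in [H j.+1]. Periodic preimages lie in
    every [H i], so the difference discards them. *)
Lemma count_children_level x j : (forall y, f y = x -> ~~ periodic f y -> y \in H 0) ->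
  count_mem j (map level (children x)) = if j < d then #|P x j| - #|P x j.+1| else 0.
Proof.
move=> xH; rewrite count_map.
case: (ltnP j d) => [lt_jd | le_dj]; last first.
  apply/eqP; rewrite -leqn0 leqNgt -has_count; apply/hasPn => y.
  rewrite mem_filter => /andP[/andP[/eqP fy ny] _] /=.
  have := nonperiodic_level_lt (xH y fy ny) ny; by lia.
have sP : P x j.+1 \subset P x j.
  by apply/subsetP => y; rewrite !inE => /andP[/(subsetP (H_sub j))-> ->].
rewrite -(cardsDS sP) count_filter -size_filter enumT cardE [in RHS]/enum_mem.
congr (size _); apply: eq_filter => y; rewrite /= !inE.
case: (eqVneq (f y) x) => [fy|]; rewrite ?andbF //= ?andbT.
apply/andP/andP => [[/eqP lj ny] | [yNj yj]].
  have y0 := xH y fy ny.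
  by rewrite (levelP y0 lt_jd) (levelP y0 (ltnW lt_jd)) lj ltnn leqnn.
have y0 : y \in H 0 by apply: (subsetP (subH (leq0n j))).
split; last by apply: contra yNj => /(H_periodic _ y0).
by move: yNj yj; rewrite (levelP y0 lt_jd) (levelP y0 (ltnW lt_jd)); lia.
Qed.

(** The recursion step common to both kinds of tree. A nonperiodic [x] of level [k] has no preimage
    in [H k], so [a] is the k-th entry of [nu]; a periodic root, with [k = d], has exactly one
    preimage in [H d], so [a] is the last entry minus 1. *)
Lemma children_tree_at x k a (T : nat -> rtree) : 0 < k <= d ->
  (forall y, f y = x -> ~~ periodic f y -> y \in H 0) ->
  (forall i, i < k -> x \in H i.+1) -> #|P x k.-1| - #|P x k| = a ->
  (forall i, k <= i < d -> #|P x i| = 0) ->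
  (forall y, f y = x -> ~~ periodic f y -> tree_at f y (T (level y))) ->
  tree_at f x (rjoin (nseq a (T k.-1) ++
    \big[cat/[::]]_(1 <= i < k) nseq (elt i - elt i.+1) (T i.-1))).
Proof.
move=> /andP[k_gt0 le_kd] xH xk xa xz xT.
rewrite -map_level_seq.
have [|ys p_ys <-] := @perm_map_lift _ _ level (children x) (level_seq elt a k).
  apply/allP => j _; rewrite /= count_children_level // count_level_seq.
  have Pi i : i < k -> #|P x i| = elt i.+1.
    move=> lt_ik; rewrite H_card ?xk //; last by lia.
    by rewrite /elt /= (set_nth_default 1) //; lia.
  case: (ltngtP j k.-1) => [lt_jk | gt_jk | ->].
  - have -> : j < d by lia.
    by rewrite !Pi //; lia.
  - by case: ifP => // lt_jd; rewrite xz //; lia.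
  - by rewrite prednK // xa le_kd.
have ysE y : (y \in ys) = (f y == x) && ~~ periodic f y.
  by rewrite (perm_mem p_ys) mem_filter mem_enum andbT.
rewrite -map_comp; apply: rjoin_tree_at => //.
- by rewrite (perm_uniq p_ys) filter_uniq // enum_uniq.
- by move=> y; rewrite ysE => /andP[/eqP fy ny]; apply: xT.
Qed.

Lemma elem_level_tree_at v x : (forall u, above f v u -> u \in H 0) ->
  above f v x -> ~~ periodic f x -> tree_at f x (elem_level nu (level x)).
Proof.
move=> vH.
have [n] := ubnP (level x); elim: n x => // n IHn x lt_n vx nx.
have x0 := vH x vx.
have lt_xd := nonperiodic_level_lt x0 nx.
have vy y : f y = x -> ~~ periodic f y -> above f v y.
  by move=> fy ny; apply/above_stepP; right; rewrite fy.
(* Since [f] maps [H i] into [H i.+1], children have smaller level, which drives the induction. *)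
have lev_y y : f y = x -> ~~ periodic f y -> level y < level x.
  move=> fy ny; have y0 := vH y (vy y fy ny).
  rewrite -levelP //; last exact: nonperiodic_level_lt.
  by rewrite -fy H_step // levelP // level_le.
have [k0 | k_gt0] := posnP (level x).
  have -> : elem_level nu (level x) = rjoin (map (fun=> bullet) ([::] : seq V)).
    by rewrite k0.
  apply: rjoin_tree_at => // y; rewrite in_nil; apply/esym/negP => /andP[/eqP fy ny].
  by have := lev_y y fy ny; rewrite k0.
rewrite elem_levelS //; apply: children_tree_at.
- by rewrite k_gt0 ltnW.
- by move=> y fy ny; apply/vH/vy.
- by move=> i lt_i; rewrite levelP //; lia.
- have xk : x \in H (level x) by rewrite (levelP x0 (ltnW lt_xd)).
  have xNk : x \notin H (level x).+1 by rewrite (levelP x0 lt_xd) ltnn.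
  rewrite [#|P x (level x)|]card_no_preimage // subn0 H_card ?prednK //; last by lia.
  by rewrite (set_nth_default 1) //; lia.
- by move=> i ik; rewrite card_no_preimage // levelP //; lia.
- move=> y fy ny; apply: IHn; [ | exact: vy | exact: ny].
  by have := lev_y y fy ny; lia.
Qed.

Lemma elem_tree_at v : periodic f v -> (forall u, above f v u -> u \in H 0) ->
  tree_at f v (elem_tree nu).
Proof.
move=> pv vH; have v0 := vH v (above_refl f v).
have vy y : f y = v -> ~~ periodic f y -> above f v y.
  by move=> fy ny; apply/above_stepP; right; rewrite fy; split=> //; apply: above_refl.
rewrite /elem_tree; apply: children_tree_at.
- by rewrite d_gt0 leqnn.
- by move=> y fy ny; apply/vH/vy.
- by move=> i _; apply: H_periodic.
- have Pv i : i <= d -> #|P v i| = nth 1 nu i.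
    by move=> le_id; apply: H_card => //; apply: H_periodic.
  rewrite (Pv _ (leq_pred d)) (Pv _ (leqnn d)) [nth 1 nu d]nth_default //.
  by rewrite (set_nth_default 1) // prednK.
- by move=> i; lia.
- by move=> y fy ny; apply: (elem_level_tree_at vH) => //; apply: vy.
Qed.

End ElementaryTrees.

(** * Cycles and disjoint unions *)

Section InducedSubgraphs.
Variables (V : finType) (f : V -> V).
Implicit Types (u v x y : V) (A B : pred V) (T : rtree) (H K : digraph).

(** [H] is a copy of the graph of [f] on [A]. Closure of [A] under [f] ensures that no edge joins
    two disjoint pieces, so that pieces add up under [dsum]. *)
Definition induces A H :=
  (forall u, A u -> A (f u)) /\
  exists g : H -> V, [/\ injective g, forall a b, edge a b = (f (g a) == g b)
    & forall u, (exists a, g a = u) <-> A u].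

Lemma eq_induces A B H : A =1 B -> induces A H -> induces B H.
Proof.
move=> AB [Af [g [g_inj g_edge g_img]]]; split=> [u|]; first by rewrite -!AB; apply: Af.
by exists g; split=> // u; rewrite g_img AB.
Qed.

Lemma induces_predT H : induces predT H -> digraph_iso (functional_graph f) H.
Proof.
case=> _ [g [g_inj g_edge g_img]].
have g_bij : bijective g.
  apply: inj_card_bij => //; rewrite -(card_codom g_inj) subset_leq_card //.
  by apply/subsetP => u _; have [a <-] := (g_img u).2 isT; apply: codom_f.
case: g_bij => h gK hK; exists h; first by exists g.
by move=> x y; rewrite g_edge !hK.
Qed.

Lemma induces_dempty A : A =1 pred0 -> induces A dempty.
Proof.
move=> A0; split=> [u|]; first by rewrite A0.
exists (fun a : void => match a with end); split=> [[] | [] | u] //.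
by rewrite A0; split=> [[[]]|].
Qed.

Lemma induces_dsum A B H K : (forall u, A u -> B u -> False) ->
  induces A H -> induces B K -> induces (predU A B) (dsum H K).
Proof.
move=> dis [Af [g [g_inj g_edge g_img]]] [Bf [h [h_inj h_edge h_img]]].
have Ag a : A (g a) by apply/g_img; exists a.
have Bh b : B (h b) by apply/h_img; exists b.
split=> [u /orP[/Af fu|/Bf fu]|]; [by rewrite /= fu | by rewrite /= fu orbT |].
exists (fun c : H + K => match c with inl a => g a | inr b => h b end).
split=> [[a|a] [b|b] /= e | [a|a] [b|b] /= | u] //.
- by rewrite (g_inj _ _ e).
- by case: (dis (g a)); rewrite ?Ag // e Bh.
- by case: (dis (h a)); rewrite ?Bh // e Ag.
- by rewrite (h_inj _ _ e).
- by apply/esym/negP => /eqP e; case: (dis (f (g a))); [apply: Af | rewrite e].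
- by apply/esym/negP => /eqP e; case: (dis (f (h a))); [rewrite e | apply: Bf].
split=> [[[a|b] <-] | /orP[/g_img[a <-]|/h_img[b <-]]].
- by rewrite /= Ag.
- by rewrite /= Bh orbT.
- by exists (inl a).
- by exists (inr b).
Qed.

Lemma induces_bigdsum (I : eqType) (r : seq I) (P : pred I) (F : I -> digraph)
    (A : I -> pred V) : uniq r ->
  (forall i, i \in r -> P i -> induces (A i) (F i)) ->
  (forall i j u, P i -> P j -> A i u -> A j u -> i = j) ->
  induces (fun u => has (fun i => P i && A i u) r) (\big[dsum/dempty]_(i <- r | P i) F i).
Proof.
elim: r => [|i r IHr] /= => [_ _ _ | /andP[ir ur] rF rA].
  by rewrite big_nil; apply: induces_dempty.
have {}IHr := IHr ur (fun j jr => rF j (@mem_behead _ (i :: r) _ jr)) rA.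
rewrite big_cons; case: ifP => // Pi.
apply: (induces_dsum _ (rF i (mem_head _ _) Pi) IHr) => u Ai /hasP[j jr /andP[Pj Aj]].
by move: ir; rewrite (rA i j u) ?jr.
Qed.

Lemma entry_step_closed (S : {pred V}) u : (forall x, x \in S -> f x \in S) ->
  entry f u \in S -> entry f (f u) \in S.
Proof.
move=> Sf; have [pu | nu] := boolP (periodic f u); last by rewrite entry_step.
rewrite (eqP (entry_periodic pu)) (eqP (entry_periodic (periodic_step pu))).
exact: Sf.
Qed.

Section Cycles.
Variables (m : nat) (T : rtree).
Hypothesis m_gt0 : 0 < m.

Definition min_period x :=
  iter m f x = x /\ forall n, 0 < n < m -> iter n f x <> x.

Lemma min_period_periodic x : min_period x -> periodic f x.
Proof. by case=> e _; apply/periodicP; exists m.-1; rewrite prednK. Qed.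

Lemma iter_min_period_inj x i j : min_period x -> i < m -> j < m ->
  iter i f x = iter j f x -> i = j.
Proof.
move=> [xm xN]; wlog lt_ij : i j / i < j.
  by move=> IH; case: (ltngtP i j) => // lt_ij li lj e; [|apply/esym]; apply: IH.
move=> li lj e; case: (xN (j - i)); first by lia.
have := congr1 (iter (m - i) f) e; rewrite -!iterD subnK 1?ltnW // xm.
by have -> : m - i + j = j - i + m by [lia]; rewrite iterD xm.
Qed.

Lemma iter_mod_period x n : min_period x -> iter n f x = iter (n %% m) f x.
Proof.
case=> xm _; rewrite {1}(divn_eq n m) addnC iterD; congr (iter _ f _).
by elim: (n %/ m) => // q IHq; rewrite mulSn iterD IHq.
Qed.

(** The trees along the cycle are embedded separately; the entry point of a vertex tells which copy
    contains it. *)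
Lemma induces_Cyc x : min_period x -> (forall i, tree_at f (iter i f x) T) ->
  induces (fun u => [exists i : 'I_m, entry f u == iter i f x]) (Cyc m T).
Proof.
move=> mx xT; have px := min_period_periodic mx.
have pi i : periodic f (iter i f x) by apply: periodic_iter.
have S_f y : y \in [pred y | [exists i : 'I_m, y == iter i f x]] ->
    f y \in [pred y | [exists i : 'I_m, y == iter i f x]].
  rewrite !inE => /existsP[i /eqP->]; apply/existsP.
  exists (Ordinal (ltn_pmod i.+1 m_gt0)); by rewrite -iterS /= -iter_mod_period.
split=> [u|]; first exact: (entry_step_closed S_f).
have [|g gP] := @fin_all_exists 'I_m (fun=> T -> V) (fun i g =>
    [/\ injective g, g (troot T) = iter i f x,
        forall a b, edge a b = (a != troot T) && (f (g a) == g b)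
      & forall u, (exists a, g a = u) <-> above f (iter i f x) u]).
  by move=> i; apply: xT.
have g_entry i a : entry f (g i a) = iter i f x.
  by have [_ _ _ g_img] := gP i; apply/above_entryP; rewrite // -g_img; exists a.
have g_inj i j a b : g i a = g j b -> i = j /\ a = b.
  move=> e; have ij : i = j.
    apply/val_inj/(iter_min_period_inj mx) => //=.
    by rewrite -(g_entry i a) e g_entry.
  by split=> //; rewrite -ij in e; have [gi _ _ _] := gP i; apply: gi.
exists (fun c : 'I_m * T => g c.1 c.2); split=> [[i a] [j b] /g_inj[/= -> ->] //| | u].
- move=> [i a] [j b] /=; have [gi g_root g_edge g_img] := gP i.
  have [-> | ar] /= := eqVneq a (troot T).
    have -> : f (g i (troot T)) = g (ordS i) (troot T).
      have [_ -> _ _] := gP (ordS i).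
      by rewrite g_root -iterS (iter_mod_period _ mx).
    rewrite g_edge eqxx andbF /=; apply/andP/eqP => [[/eqP-> /eqP->] // | /g_inj[-> ->] //].
  rewrite orbF; have [<- | ij] /= := eqVneq i j; first by rewrite g_edge ar.
  (* A step from a vertex other than the root keeps the entry point, hence the copy. *)
  apply/esym/negP => /eqP e; case/eqP: ij.
  apply/val_inj/(iter_min_period_inj mx) => //=.
  rewrite -(g_entry j b) -e -(g_entry i a) entry_step //.
  apply: (@above_nonperiodic _ _ (iter i f x)); last by apply/g_img; exists a.
  by rewrite -g_root (inj_eq gi).
split=> [[[i a] <-] /= | /existsP[i /eqP eu]].
  by apply/existsP; exists i; rewrite g_entry.
have [_ _ _ g_img] := gP i.
by have [|a <-] := (g_img u).2; [apply/above_entryP | exists (i, a)].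
Qed.

(** Induction on the size of [S], removing one cycle of [m] elements at a time. *)
Lemma induces_cycles (S : {set V}) : (forall x, x \in S -> f x \in S) ->
  (forall x, x \in S -> min_period x /\ tree_at f x T) ->
  induces (fun u => entry f u \in S) (dcopies (#|S| %/ m) (Cyc m T)).
Proof.
have [n] := ubnP #|S|; elim: n S => // n IHn S lt_n Sf SP.
have [-> | [x xS]] := set_0Vmem S.
  by rewrite cards0 div0n; apply: induces_dempty => u; rewrite inE.
have [mx _] := SP x xS.
have iterS i : iter i f x \in S by elim: i => //= i; apply: Sf.
set O := [set iter (i : 'I_m) f x | i : 'I_m].
have inO i : iter i f x \in O.
  rewrite (iter_mod_period _ mx); apply/imsetP.
  by exists (Ordinal (ltn_pmod i m_gt0)).
have OS : O \subset S by apply/subsetP => _ /imsetP[i _ ->].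
have cardO : #|O| = m.
  rewrite card_imset ?card_ord // => i j e.
  exact/val_inj/(iter_min_period_inj mx _ _ e).
have cS : #|S| = m + #|S :\: O| by rewrite cardsDS // cardO subnKC // -cardO subset_leq_card.
rewrite cS divnDl // divnn m_gt0 add1n.
apply: (@eq_induces (predU (fun u => [exists i : 'I_m, entry f u == iter i f x])
    (fun u => entry f u \in S :\: O))).
  move=> u /=; rewrite in_setD.
  have -> : [exists i : 'I_m, entry f u == iter i f x] = (entry f u \in O).
    by apply/existsP/imsetP => [[i /eqP->] | [i _ ->]]; exists i.
  by case: (boolP (_ \in O)) => // /(subsetP OS)->.
apply: induces_dsum.
- by move=> u /existsP[i /eqP->]; rewrite inE inO.
- by apply: induces_Cyc => // i; case: (SP _ (iterS i)).
apply: IHn; first by lia.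
  (* The rest of [S] stays closed: [y] is the (m-1)-th iterate of [f y], so [f y] in [O] would put
     [y] in [O]. *)
  move=> y /setDP[yS yO]; rewrite inE Sf // andbT; apply: contra yO => /imsetP[i _ e].
  have [[my _] _] := SP y yS.
  by rewrite -my -(prednK m_gt0) iterSr e -iterD.
by move=> y /setDP[yS _]; apply: SP.
Qed.

End Cycles.
End InducedSubgraphs.

(** * Arithmetic and cyclic groups *)

Section OmegaPart.
Variables (t c : nat).
Hypotheses (t_gt0 : 0 < t) (c_gt0 : 0 < c).

Lemma omega_partE : omega_part t c = c`_(\pi(t)^').
Proof.
apply/eqP; rewrite eqn_leq; apply/andP; split.
  apply/bigmax_leqP_seq => d; rewrite -dvdn_divisors // => dc co.
  apply: dvdn_leq; first exact: part_gt0.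
  have d_gt0 : 0 < d by apply: dvdn_gt0 dc.
  rewrite -[d](part_pnat_id (pi := \pi(t)^')); first exact: partn_dvd.
  by rewrite -coprime_pi' // coprime_sym.
apply: (@leq_bigmax_seq _ _ _ id); first by rewrite -dvdn_divisors // dvdn_part.
by rewrite coprime_sym coprime_pi' ?part_pnat // part_gt0.
Qed.

(** Being the part of [c] prime to [t], [omega_part] is largest for divisibility as well as for
    size. Its divisors are thus the orders of the periodic elements of a cyclic group of order
    [c]. *)
Lemma dvdn_omega_part d : (d %| omega_part t c) = (d %| c) && coprime d t.
Proof.
rewrite omega_partE; apply/idP/andP => [dw | [dc co]].
  have d_gt0 : 0 < d by apply: dvdn_gt0 dw; apply: part_gt0.
  split; first by apply: dvdn_trans dw (dvdn_part _ _).
  by rewrite coprime_sym coprime_pi' // (pnat_dvd dw) // part_pnat.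
have d_gt0 : 0 < d by apply: dvdn_gt0 dc.
rewrite -[d](part_pnat_id (pi := \pi(t)^')); first exact: partn_dvd.
by rewrite -coprime_pi' // coprime_sym.
Qed.

Lemma omega_part_dvd : omega_part t c %| c.
Proof. by have := dvdn_omega_part (omega_part t c); rewrite dvdnn => /esym/andP[]. Qed.

Lemma coprime_omega_part : coprime (omega_part t c) t.
Proof. by have := dvdn_omega_part (omega_part t c); rewrite dvdnn => /esym/andP[]. Qed.

Lemma omega_part_gt0 : 0 < omega_part t c.
Proof. exact: dvdn_gt0 c_gt0 omega_part_dvd. Qed.

Lemma nu_omega_part : nu_part t c * omega_part t c = c.
Proof. exact: divnK omega_part_dvd. Qed.

Lemma nu_part_gt0 : 0 < nu_part t c.
Proof. by have := c_gt0; rewrite -{1}nu_omega_part muln_gt0 => /andP[]. Qed.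

End OmegaPart.

Section IteratedGcd.
Variables (t w : nat).
Hypothesis co_tw : coprime t w.

(** Order of the i-th iterated image of a cyclic group of order [n] under the t-th power map. *)
Definition gcd_residue n i := iter i (fun m => m %/ gcdn t m) n.
Arguments gcd_residue : simpl never.

Lemma gcd_residue_coprime n : coprime t n -> gcd_residue (n * w) 1 = n * w.
Proof.
move=> co; rewrite /gcd_residue /=.
by have /eqP-> : coprime t (n * w); rewrite ?coprimeMr ?co // divn1.
Qed.

(** The factor [w] is carried along because petals have order [n * w]; being coprime to [t], it
    changes none of the gcds. *)
Lemma iter_gcd_recP fuel n : 0 < n <= fuel ->
  let s := iter_gcd_rec fuel t n in
  (forall i, i < size s -> nth 0 s i = gcdn t (gcd_residue (n * w) i)) /\
  coprime t (gcd_residue (n * w) (size s)).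
Proof.
elim: fuel n => [|fuel IH] n /=; first by lia.
move=> /andP[n_gt0 le_n]; case: ifP => co /=; first by rewrite coprimeMr co.
set g := gcdn t n.
have g_gt1 : 1 < g.
  by rewrite ltn_neqAle eq_sym -[g == 1]/(coprime t n) co /= gcdn_gt0 n_gt0 orbT.
have gE : gcdn t (n * w) = g by rewrite Gauss_gcdl.
have dE : n * w %/ g = n %/ g * w by rewrite divn_mulAC ?dvdn_gcdr.
have [|nthE coE] := IH (n %/ g).
  rewrite divn_gt0 ?(ltnW g_gt1) // dvdn_leq ?dvdn_gcdr //=.
  by rewrite -ltnS; apply: leq_trans le_n; apply: ltn_Pdiv.
have rE i : gcd_residue (n * w) i.+1 = gcd_residue (n %/ g * w) i.
  by rewrite /gcd_residue iterSr gE dE.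
split=> [[|i]|] /=; [by rewrite /gcd_residue /= gE | | by rewrite rE].
by rewrite ltnS => lt_i; rewrite nthE // rE.
Qed.

Lemma iter_gcdP n : 0 < n ->
  let s := iter_gcd t n in
  [/\ 0 < size s, forall i, i < size s -> nth 0 s i = gcdn t (gcd_residue (n * w) i)
    & coprime t (gcd_residue (n * w) (size s))].
Proof.
move=> n_gt0; rewrite /iter_gcd; case: ifP => co.
  have cow : coprime t (n * w) by rewrite coprimeMr co.
  split=> //= [[|i]|] //; last by rewrite gcd_residue_coprime.
  by rewrite /gcd_residue /= (eqP cow).
have [|nthE coE] := @iter_gcd_recP n n; first by rewrite n_gt0 leqnn.
split=> //; case: n n_gt0 co {nthE coE} => //= n _; by case: ifP.
Qed.

End IteratedGcd.

Section CyclicGroups.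
Variable gT : finGroupType.
Implicit Types (D : {group gT}) (a b x y : gT).
Local Open Scope group_scope.

(** These elements form the unique subgroup of order [m], generated by [b]. *)
Lemma card_order_dvd D m : cyclic D -> m %| #|D| -> #|[set x in D | #[x] %| m]| = m.
Proof.
case/cyclicP=> a defD mD; rewrite defD in mD *.
have a_gt0 := order_gt0 a.
set b := a ^+ (#[a] %/ m).
have ob : #[b] = m by rewrite /b orderXdiv ?dvdn_div // divnA // mulKn.
have bD : b \in <[a]> by apply: mem_cycle.
rewrite -[RHS]ob; apply: eq_card => x; rewrite !inE.
apply/andP/idP => [[xa xm] | xb].
  have := cardSg_cyclic (cycle_cyclic a) (_ : <[x]> \subset _) (_ : <[b]> \subset _).
  by rewrite !cycle_subG => /(_ xa bD); rewrite -!orderE ob xm => /esym.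
split; first by apply: subsetP xb; rewrite cycle_subG.
by rewrite -ob order_dvdG.
Qed.

Lemma card_order_eq D d : cyclic D -> d %| #|D| -> #|[set x in D | #[x] == d]| = totient d.
Proof.
case/cyclicP=> a defD dD; rewrite defD in dD *.
have a_gt0 := order_gt0 a.
set b := a ^+ (#[a] %/ d).
have ob : #[b] = d by rewrite /b orderXdiv ?dvdn_div // divnA // mulKn.
have bD : b \in <[a]> by apply: mem_cycle.
rewrite -[in RHS]ob totient_gen; apply: eq_card => x; rewrite !inE /generator.
apply/andP/eqP => [[xa /eqP xd] | bx].
  apply/eqP; rewrite (eq_subG_cyclic (cycle_cyclic a)) ?cycle_subG //.
  by rewrite -!orderE xd ob.
by rewrite -cycle_subG -bx cycle_subG bD orderE -bx -orderE ob.
Qed.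

(** The fibre is a coset of the kernel of the t-th power map on [<[b]>], which consists of the
    elements of order dividing [gcdn t #[b]]. *)
Lemma card_root t b x : x \in <[b ^+ t]> ->
  #|[set y in <[b]> | y ^+ t == x]| = gcdn t #[b].
Proof.
case/cycleP=> i xE; set z := b ^+ i.
have zb : z \in <[b]> by apply: mem_cycle.
have zt : z ^+ t = x by rewrite xE /z -!expgM mulnC.
rewrite -[RHS](@card_order_dvd <[b]>) ?cycle_cyclic ?dvdn_gcdr //.
rewrite -[RHS](card_imset _ (mulIg z)).
apply: eq_card => y; rewrite !inE; apply/andP/imsetP => [[yb /eqP yt] | [u]].
  exists (y * z^-1); last by rewrite mulgKV.
  have yz : commute y z^-1.
    by apply: (centsP (cycle_abelian b)); rewrite // groupV.
  rewrite inE groupM ?groupV //= dvdn_gcd order_dvdG ?groupM ?groupV // andbT.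
  by rewrite order_dvdn expgMn // expgVn yt zt mulgV.
rewrite inE => /andP[ub]; rewrite dvdn_gcd => /andP[ut _] ->.
split; first by rewrite groupM.
have uz : commute u z by apply: (centsP (cycle_abelian b)).
by rewrite expgMn // zt; move: ut; rewrite order_dvdn => /eqP->; rewrite mul1g.
Qed.

End CyclicGroups.

(** * Power maps *)

Section PowerMaps.
Variables (gT : finGroupType) (t : nat).
Hypothesis t_gt0 : 0 < t.
Implicit Types (D : {group gT}) (a b u v x y : gT).
Local Open Scope group_scope.
Local Notation pow := (fun x : gT => x ^+ t).

Lemma iter_pow n x : iter n pow x = x ^+ (t ^ n).
Proof. by elim: n => [|n IHn]; rewrite ?expg1 // iterS IHn -expgM -expnSr. Qed.

Lemma iter_powM n x y : commute x y ->
  iter n pow (x * y) = iter n pow x * iter n pow y.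
Proof. by move=> cxy; rewrite !iter_pow expgMn. Qed.

Lemma iter_pow_mem D n x : x \in D -> iter n pow x \in D.
Proof. by move=> xD; rewrite iter_pow groupX. Qed.

Lemma expg_eq_id x n : (x ^+ n == x) = (n == 1 %[mod #[x]]).
Proof. by rewrite -[X in _ == X]expg1 eq_expg_mod_order. Qed.

Lemma periodic_pow x : periodic pow x = coprime #[x] t.
Proof.
apply/periodicP/idP => [[n] | co].
  rewrite iter_pow => /eqP; rewrite expg_eq_id => /eqP e.
  have : coprime (t ^ n.+1) #[x] by rewrite /coprime -gcdn_modl e gcdn_modl gcd1n.
  by rewrite coprime_pexpl // coprime_sym.
exists (mulord #[x] t).-1; rewrite prednK // iter_pow.
rewrite coprime_sym in co; have [e _] := mulordP (order_gt0 x) co.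
by apply/eqP; rewrite expg_eq_id e.
Qed.

Lemma min_period_pow x : coprime #[x] t -> min_period pow (mulord #[x] t) x.
Proof.
rewrite coprime_sym => co; have [e eN] := mulordP (order_gt0 x) co.
split=> [|n lt_n]; rewrite iter_pow.
  by apply/eqP; rewrite expg_eq_id e.
by move/eqP; rewrite expg_eq_id => /eqP; apply: eN.
Qed.

Lemma order_pow x : coprime #[x] t -> #[x ^+ t] = #[x].
Proof. by move=> /eqP co; rewrite orderXgcd co divn1. Qed.

Lemma periodic_powM x y : commute x y ->
  periodic pow x -> periodic pow y -> periodic pow (x * y).
Proof.
rewrite !periodic_pow => cxy cx cy.
have : #[x * y] %| #[x] * #[y].
  by rewrite order_dvdn expgMn // expgM mulnC expgM !expg_order !expg1n mulg1.
by move/coprime_dvdl; apply; rewrite coprimeMl cx.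
Qed.

Lemma periodic_powV x : periodic pow x -> periodic pow x^-1.
Proof. by rewrite !periodic_pow orderV. Qed.

(** Instance of the abstract petal with [H i] generated by [a ^+ (t ^ i)], for a generator [a] of
    [D]. The last hypothesis keeps all that flows into [v] inside [D]. *)
Lemma petal_tree_at D (n w : nat) v : cyclic D -> #|D| = (n * w)%N -> 0 < n -> coprime t w ->
  coprime #[v] t -> (forall u j, iter j pow u = v -> u \in D) ->
  tree_at pow v (elem_tree (iter_gcd t n)).
Proof.
case/cyclicP=> a defD oD n_gt0 co_tw co_v vD.
have [s_gt0 nthE coE] := iter_gcdP co_tw n_gt0.
set s := iter_gcd t n in s_gt0 nthE coE *.
have oa i : #[a ^+ (t ^ i)] = gcd_residue t (n * w) i.
  elim: i => [|i IHi]; first by rewrite expg1 orderE -defD oD.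
  by rewrite expnSr expgM orderXgcd IHi gcdnC.
apply: (@elem_tree_at _ _ s (fun i => <[a ^+ (t ^ i)]>)) => //.
- by move=> i x /cycleP[j ->]; rewrite expnSr (expgM a) (expgAC _ j) mem_cycle.
- by move=> i; rewrite cycle_subG expnSr expgM mem_cycle.
- move=> i x le_i; rewrite expnSr expgM => /card_root->; rewrite oa.
  move: le_i; rewrite leq_eqVlt => /orP[/eqP-> | lt_i].
    by rewrite nth_default // (eqP coE).
  by rewrite (set_nth_default 0) // nthE.
- move=> i x; rewrite expg1 => /cycleP[j xE]; rewrite periodic_pow => co.
  (* As [x] has order coprime to [t], its power [x ^+ (t ^ i)] still generates [<[x]>], which puts
     [x] in the i-th image. *)
  have /cycleP[l xl] : x \in <[x ^+ (t ^ i)]>.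
    have -> : <[x ^+ (t ^ i)]> = <[x]>; last exact: cycle_id.
    by apply/esym/eqP; rewrite -/(generator _ _) generator_coprime coprimeXr.
  by rewrite xl groupX // xE expgAC mem_cycle.
- move=> x xd; rewrite periodic_pow.
  by have := order_dvdG xd; rewrite -orderE oa => /coprime_dvdl; apply; rewrite coprime_sym.
- by rewrite periodic_pow.
by move=> u [j uj _]; rewrite expg1 -defD; apply: vD uj.
Qed.

(* If [s] inverts [t] modulo the order of the central element [v], then
   [u |-> v ^+ s ^ depth u * u] maps the central tree onto the tree at [v]. *)
Lemma central_tree_at (p1 : periodic pow 1) v : (forall x, commute v x) ->
  coprime #[v] t -> tree_at pow v (attached_tree p1).
Proof.
move=> cv co_v.
have [s vs] : exists s, v ^+ (s * t) = v.
  exists (t ^ (mulord #[v] t).-1)%N; rewrite -expnSr prednK // -iter_pow.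
  by have [] := min_period_pow co_v.
have pv : periodic pow v by rewrite periodic_pow.
have vst j : v ^+ (s ^ j * t ^ j) = v.
  by elim: j => [|j IHj]; rewrite ?expg1 // !expnS mulnACA expgM vs.
have pvs j : periodic pow (v ^+ j).
  by rewrite periodic_pow; apply: coprime_dvdl (orderXdvd _ _) co_v.
have cvs j x : commute (v ^+ j) x by apply/commute_sym/commuteX/commute_sym.
pose g u := v ^+ (s ^ depth pow u) * u.
(* Multiplying by a periodic central element does not affect periodicity; hence [g] preserves
   depth. *)
have g_iter_periodic u i : periodic pow (iter i pow (g u)) = periodic pow (iter i pow u).
  rewrite iter_powM // [iter i _ (v ^+ _)]iter_pow -expgM.
  set e := (_ * _)%N; apply/idP/idP => [p | ]; last exact: periodic_powM.
  rewrite -[iter i _ u](mulKg (v ^+ e)); apply: periodic_powM => //; last exact/periodic_powV.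
  by apply/commute_sym/commuteV/commute_sym.
have g_depth u : depth pow (g u) = depth pow u.
  apply: depth_eq => [|i lt_i]; rewrite g_iter_periodic.
    by rewrite iter_depth periodic_entry.
  exact: lt_depth.
have g_entry u : entry pow (g u) = v * entry pow u.
  by rewrite -!iter_depth g_depth iter_powM // iter_pow -expgM vst.
(* The depth drops by one, and the factor [t] cancels one [s] in the exponent. *)
have g_step u : ~~ periodic pow u -> g u ^+ t = g (u ^+ t).
  move=> nu; rewrite /g expgMn // (depth_step nu) expnS.
  by rewrite -expgM mulnAC expgM vs.
have g_inj u1 u2 : g u1 = g u2 -> u1 = u2.
  move=> eg; have := eg; rewrite /g -(g_depth u1) eg g_depth.
  exact: mulgI.
have entry1 (a : attached_tree p1) : entry pow (val a) = 1 by apply/eqP/(valP a).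
exists (fun a : attached_tree p1 => g (val a)); split.
- by move=> a b /g_inj/val_inj.
- have /eqP d0 : depth pow (1 : gT) == 0 by rewrite depth_periodic.
  by rewrite /= /g d0 expg1 mulg1.
- move=> a b /=; rewrite -(inj_eq val_inj) /=.
  have [//|a1] := eqVneq (val a) 1.
  have na : ~~ periodic pow (val a).
    by apply: contra a1 => /entry_periodic; rewrite entry1 eq_sym.
  by rewrite g_step //=; apply/eqP/eqP => [-> //|/g_inj].
move=> u; rewrite above_entryP //; split=> [[a <-] | eu].
  by rewrite g_entry entry1 mulg1.
(* The preimage of [u] under [g]: its exponent uses the depth of [u], which [dy] shows to be that of
   [y]. *)
pose y := (v ^+ (s ^ depth pow u))^-1 * u.
have cvy j : commute (v ^+ j)^-1 u by apply/commute_sym/commuteV/commute_sym.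
have yE i : iter i pow y = (v ^+ (s ^ depth pow u * t ^ i))^-1 * iter i pow u.
  by rewrite iter_powM // iter_pow expgVn expgM.
have dy : depth pow y = depth pow u.
  apply: depth_eq => [|i lt_i]; rewrite yE.
    rewrite vst iter_depth eu; apply: periodic_powM => //; last exact: periodic_powV.
    by apply/commute_sym/commuteV.
  apply: contra (lt_depth lt_i) => p.
  rewrite -[iter i _ u](mulKVg (v ^+ (s ^ depth pow u * t ^ i))).
  exact: periodic_powM.
have ey : entry pow y == 1 by rewrite -iter_depth dy yE vst iter_depth eu mulVg.
by exists (exist _ y ey); rewrite /= /g dy mulKVg.
Qed.

(** An element flows into 1 when some [t ^ n] annihilates it, that is, when all primes dividing its
    order divide [t]. *)
Lemma entry_pow_eq1 D u : u \in D ->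
  (entry pow u == 1) = (#[u] %| nu_part t #|D|).
Proof.
move=> uD; have D_gt0 := cardG_gt0 D.
have nw := nu_omega_part t_gt0 D_gt0; have co_w := coprime_omega_part t_gt0 D_gt0.
rewrite -iter_depth iter_pow.
apply/idP/idP => [e1 | un].
  have : #[u] %| #|D| by apply: order_dvdG.
  rewrite -{1}nw Gauss_dvdl //.
  move: e1; rewrite -order_dvdn => /coprime_dvdl; apply.
  by rewrite coprime_sym coprimeXr.
(* The order of the entry point and [omega_part] are coprime to [t], and their product divides
   [#|D|]; so the product divides [omega_part], and the order is 1. *)
rewrite -order_eq1 -dvdn1 -(@dvdn_pmul2r (omega_part t #|D|)) ?omega_part_gt0 // mul1n.
rewrite dvdn_omega_part // coprimeMl co_w andbT -periodic_pow -iter_pow iter_depth.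
rewrite periodic_entry andbT -{2}nw dvdn_mul // -iter_depth iter_pow.
exact: dvdn_trans (orderXdvd _ _) un.
Qed.

End PowerMaps.

(** * Flower groups *)

(** The flower group is here the whole type [gT], so that the power map acts on all of it; [D0] is
    the pistil. *)
Section Petals.
Variables (gT : finGroupType) (t k : nat) (D0 : {group gT}) (D : 'I_k -> {group gT}).
Hypothesis t_gt0 : 0 < t.
Hypothesis k_gt1 : 1 < k.
Hypothesis D_cyclic : forall i, cyclic (D i).
Hypothesis D_cover : forall x, exists i, x \in D i.
Hypothesis D_meet : forall i j, i != j -> D i :&: D j = D0.
Implicit Types (x u v : gT) (i j : 'I_k) (E : {group gT}).
Local Notation pow := (fun x : gT => (x ^+ t)%g).

Lemma pistil_sub i : D0 \subset D i.
Proof.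
pose j : 'I_k := if val i == 0 then Ordinal k_gt1 else Ordinal (ltnW k_gt1).
have ij : i != j by rewrite /j -(inj_eq val_inj); case: (eqVneq (val i) 0) => [-> | ].
by rewrite -(D_meet ij) subsetIl.
Qed.

Lemma pistil_cyclic : cyclic D0.
Proof. exact: cyclicS (pistil_sub (Ordinal k_gt1)) (D_cyclic _). Qed.

Lemma petal_uniq i j x : x \notin D0 -> x \in D i -> x \in D j -> i = j.
Proof.
move=> xN xi xj; apply/eqP; apply: contraNT xN => ij.
by rewrite -(D_meet ij) inE xi.
Qed.

Lemma pistil_commute v x : v \in D0 -> commute v x.
Proof.
move=> v0; have [i xi] := D_cover x.
by apply: (centsP (cyclic_abelian (D_cyclic i))); rewrite // (subsetP (pistil_sub i)).
Qed.

(** Subgroups of a cyclic petal are compared by their orders; this turns the divisibility conditions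
    of the double sum into membership in the pistil. *)
Lemma mem_pistil i x : x \in D i -> (x \in D0) = (#[x]%g %| #|D0|).
Proof.
move=> xi; rewrite -cycle_subG orderE.
by rewrite (cardSg_cyclic (D_cyclic i)) ?pistil_sub // cycle_subG.
Qed.

Lemma induces_order_cycles E d T : cyclic E -> d %| omega_part t #|E| ->
  (forall v, v \in E -> #[v]%g = d -> tree_at pow v T) ->
  induces pow (fun u => entry pow u \in [set x in E | #[x]%g == d])
    (dcopies (totient d %/ mulord d t) (Cyc (mulord d t) T)).
Proof.
move=> cE; rewrite dvdn_omega_part // => /andP[dE co] ET.
rewrite -(card_order_eq cE dE); apply: induces_cycles => // x; rewrite !inE => /andP[xE /eqP xd].
  by rewrite groupX //= order_pow xd.
by split; [rewrite -xd; apply: min_period_pow; rewrite xd | apply: ET].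
Qed.

(** An element flowing into [v] lies in some petal, which then contains [v]; as [v] is outside the
    pistil, that petal is [D i]. *)
Lemma outer_tree_at i v : v \in D i -> v \notin D0 -> coprime #[v]%g t ->
  tree_at pow v (elem_tree (iter_gcd t (nu_part t #|D i|))).
Proof.
move=> vi vN co; have c_gt0 := cardG_gt0 (D i).
apply: (@petal_tree_at _ t (D i) _ (omega_part t #|D i|)) => //.
- by rewrite nu_omega_part.
- exact: nu_part_gt0.
- by rewrite coprime_sym coprime_omega_part.
move=> u n uv; have [j uj] := D_cover u.
by rewrite (petal_uniq vN vi (j := j)) // -uv iter_pow_mem.
Qed.

(** Vertices are sorted by their entry points: in the pistil by order, outside it by the unique
    petal and the order. *)
Lemma induces_petals (p1 : periodic pow 1%g) :
  induces pow predT
    (dsum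
      (\big[dsum/dempty]_(i < k)
         \big[dsum/dempty]_(d <- divisors (omega_part t #|D i|)
                           | ~~ (d %| omega_part t #|D0|))
            dcopies (totient d %/ mulord d t)
              (Cyc (mulord d t) (elem_tree (iter_gcd t (nu_part t #|D i|)))))
      (\big[dsum/dempty]_(d <- divisors (omega_part t #|D0|))
         dcopies (totient d %/ mulord d t)
           (Cyc (mulord d t) (attached_tree p1)))).
Proof.
pose S (E : {group gT}) d u := entry pow u \in [set x in E | #[x]%g == d].
have w_gt0 E : 0 < omega_part t #|E| by rewrite omega_part_gt0.
have inS E d u : S E d u -> entry pow u \in E /\ #[entry pow u]%g = d.
  by rewrite /S inE => /andP[-> /eqP].
have co u : coprime #[entry pow u]%g t by rewrite -periodic_pow // periodic_entry.
(* The order of an entry point is coprime to [t], so if it divides [#|D0|] it divides the omega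
   part. *)
have outer d i u : ~~ (d %| omega_part t #|D0|) -> S (D i) d u -> entry pow u \notin D0.
  move=> dN /inS[ui ud]; rewrite (mem_pistil ui) ud; apply: contra dN => d0.
  by rewrite dvdn_omega_part ?cardG_gt0 // d0 -ud co.
pose A i u := has (fun d => ~~ (d %| omega_part t #|D0|) && S (D i) d u)
  (divisors (omega_part t #|D i|)).
have AP i u : A i u -> entry pow u \in D i /\ entry pow u \notin D0.
  by case/hasP=> d _ /andP[dN uS]; split; [case/inS: uS | apply: outer dN uS].
apply: eq_induces (induces_dsum
  (A := fun u => has (fun i => true && A i u) (index_enum 'I_k))
  (B := fun u => has (fun d => true && S D0 d u) (divisors (omega_part t #|D0|))) _ _ _).
- move=> u /=; have [i ui] := D_cover (entry pow u).
  have dvd E : entry pow u \in E -> #[entry pow u]%g \in divisors (omega_part t #|E|).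
    by move=> uE; rewrite -dvdn_divisors // dvdn_omega_part ?cardG_gt0 // co order_dvdG.
  apply/orP; case: (boolP (entry pow u \in D0)) => u0; [right | left]; apply/hasP.
    by exists #[entry pow u]%g; rewrite ?dvd //= /S inE u0 eqxx.
  exists i; rewrite ?mem_index_enum //=; apply/hasP; exists #[entry pow u]%g; first exact: dvd.
  rewrite /S inE ui eqxx !andbT; apply: contra u0 => d0.
  rewrite (mem_pistil ui); apply: dvdn_trans d0 _.
  by rewrite omega_part_dvd ?cardG_gt0.
- move=> u /hasP[i _ /AP[_ /negP uN]] /hasP[d _ /inS[u0 _]]; exact: uN.
- apply: induces_bigdsum => [|i _ _|i j u _ _ /AP[ui uN] /AP[uj _]].
  + exact: index_enum_uniq.
  + apply: induces_bigdsum => [|d dD dN|d e u _ _ /inS[_ <-] /inS[_ <-]] //.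
      exact: divisors_uniq.
    apply: induces_order_cycles => // [|v vi vd]; first by rewrite dvdn_divisors.
    move: dD; rewrite -dvdn_divisors // dvdn_omega_part ?cardG_gt0 // => /andP[_ co_d].
    apply: outer_tree_at; rewrite ?vd // (mem_pistil vi) vd.
    by apply: contra dN => d0; rewrite dvdn_omega_part ?cardG_gt0 // d0.
  + exact: petal_uniq uN ui uj.
apply: induces_bigdsum => [|d dD _|d e u _ _ /inS[_ <-] /inS[_ <-]] //.
  exact: divisors_uniq.
move: dD; rewrite -dvdn_divisors // => dD.
apply: induces_order_cycles => // [|v v0 vd]; first exact: pistil_cyclic.
apply: central_tree_at => // [x|]; first exact: pistil_commute.
by move: dD; rewrite dvdn_omega_part ?cardG_gt0 // vd => /andP[].
Qed.

(** The central tree has [nu_part t #|D i|] elements in [D i] and [nu_part t #|D0|] in the pistil.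
    Outside the pistil the petals are disjoint, so the differences [a i] add up. *)
Lemma card_central_tree (p1 : periodic pow 1%g) :
  #|attached_tree p1| = \sum_(i < k) nu_part t #|D i| - (k - 1) * nu_part t #|D0|.
Proof.
rewrite card_sig; set X := [set u | entry pow u == 1%g].
have -> : #|[pred u | entry pow u == 1%g]| = #|X|.
  by apply: eq_card => u; rewrite !inE.
have cardX E : cyclic E -> #|X :&: E| = nu_part t #|E|.
  move=> cE; rewrite -[RHS](card_order_dvd cE); last first.
    by rewrite -{2}(@nu_omega_part t #|E|) ?cardG_gt0 // dvdn_mulr.
  apply: eq_card => u; rewrite !inE andbC; case: (boolP (u \in E)) => //= uE.
  by rewrite (entry_pow_eq1 t_gt0 uE).
pose a i := #|(X :&: D i) :\: D0|.
have cardi i : nu_part t #|D i| = nu_part t #|D0| + a i.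
  rewrite -(cardX _ (D_cyclic i)) -(cardsID D0 (X :&: D i)) -setIA.
  by rewrite (setIidPr (pistil_sub i)) cardX ?pistil_cyclic.
have cardXD : #|X :\: D0| = \sum_(i < k) a i.
  rewrite -sum1_card.
  under [RHS]eq_bigr => i _ do rewrite /a -sum1_card big_mkcond /=.
  rewrite exchange_big big_mkcond /=; apply: eq_bigr => u _.
  case: (boolP (u \in X :\: D0)) => uX; last first.
    rewrite big1 // => i _; case: ifP => // uXi.
    by case/negP: uX; move: uXi; rewrite !inE => /and3P[-> ->].
  have [uX1 uN] := setDP uX.
  have [i ui] := D_cover u; rewrite (bigD1 i) //= !inE uN ui andbT.
  rewrite big1 ?addn0 => [|j ji]; first by move: uX1; rewrite inE => ->.
  case: ifP => //; rewrite !inE => /and3P[_ _ uj].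
  by case/eqP: ji; apply: petal_uniq uN uj ui.
rewrite -(cardsID D0 X) (cardX _ pistil_cyclic) cardXD.
under [in RHS]eq_bigr => i _ do rewrite cardi.
rewrite big_split /= sum_nat_const card_ord mulnBl mul1n.
by rewrite subnBA ?leq_pmull ?(ltnW k_gt1) // -addnA addKn addnC.
Qed.

End Petals.

(** Every cyclic subgroup extends to a maximal one, so the petals cover [G]; a single petal would
    make [G] cyclic. *)
Lemma flower_petals (gT : finGroupType) (G : {group gT}) k (C0 : {group gT})
    (C : 'I_k -> {group gT}) : flower G C0 C ->
  [/\ 1 < k, forall i, (C i \subset G) && cyclic (C i)
    & forall x, x \in G -> exists i, x \in C i].
Proof.
case=> ncG C_inj C_max C_meet.
have C_mu i : (C i \subset G) && cyclic (C i).
  have : mu_subgroup G (C i) by apply/C_max; exists i.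
  by case/maxgroupP.
have cover x : x \in G -> exists i, x \in C i.
  move=> xG; have [|M maxM sM] := @maxgroup_exists _
    (fun D : {group gT} => (D \subset G) && cyclic D) <[x]>%G.
    by rewrite cycle_subG xG cycle_cyclic.
  have [i Ci] := (C_max M).1 maxM.
  by exists i; rewrite Ci -cycle_subG.
split=> //; rewrite ltnNge; apply: contra ncG => k_le1.
have [i _] := cover 1%g (group1 G).
have /andP[sCi cCi] := C_mu i; apply: cyclicS cCi; apply/subsetP => x /cover[j].
suff -> : j = i by [].
have ord_eq0 (l : 'I_k) : val l = 0.
  by apply/eqP; rewrite -leqn0 -ltnS (leq_trans (ltn_ord l)).
by apply: val_inj; rewrite !ord_eq0.
Qed.

Theorem theorem3p9 (t : nat) (gT : finGroupType) (G : {group gT})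
    (k c0 : nat) (c : 'I_k -> nat) :
  0 < t -> flower_of_type G c0 c ->
  let omega := fun i => omega_part t (c i) in
  let nu := fun i => nu_part t (c i) in
  let omega0 := omega_part t c0 in
  let nu0 := nu_part t c0 in
  digraph_iso (power_graph t G)
    (dsum
      (\big[dsum/dempty]_(i < k)
         \big[dsum/dempty]_(d <- divisors (omega i) | ~~ (d %| omega0))
            dcopies (totient d %/ mulord d t)
              (Cyc (mulord d t) (elem_tree (iter_gcd t (nu i)))))
      (\big[dsum/dempty]_(d <- divisors omega0)
         dcopies (totient d %/ mulord d t)
           (Cyc (mulord d t) (central_tree t G))))
  /\ #|vert (central_tree t G)| = \sum_(i < k) nu i - (k - 1) * nu0.
Proof.
move=> t_gt0 [C0 [C [flG -> cE]]] omega nu omega0 nu0.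
have [k_gt1 C_mu C_cover] := flower_petals flG.
have [_ _ _ C_meet] := flG.
have CG i : C i \subset G by case/andP: (C_mu i).
have C0G : C0 \subset G.
  by rewrite -(C_meet (Ordinal (ltnW k_gt1)) (Ordinal k_gt1)) // subIset // CG.
(* The vertices of the power graph form [subg_of G]; the injective morphism [subg G] carries petals
   and pistil there, preserving orders and intersections. *)
pose D i := (subg G @* C i)%G; pose D0 := (subg G @* C0)%G.
have cardD (E : {group gT}) : E \subset G -> #|(subg G @* E)%g| = #|E|.
  by move=> EG; rewrite card_injm ?injm_subg.
have D_cyclic i : cyclic (D i) by apply: morphim_cyclic; case/andP: (C_mu i).
have D_cover x : exists i, x \in D i.
  have [i xi] := C_cover _ (subgP x); exists i.
  by rewrite -(sgvalK x) mem_morphim ?subgP.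
have D_meet i j : i != j -> D i :&: D j = D0.
  move=> ij; rewrite /= -injmI ?injm_subg //; congr (_ @* _)%g.
  by case: (ltngtP i j) ij => [/C_meet-> | /C_meet <- | /val_inj->]; rewrite ?eqxx // setIC.
have omegaE i : omega i = omega_part t #|D i| by rewrite /omega cE cardD.
have nuE i : nu i = nu_part t #|D i| by rewrite /nu cE cardD.
have -> : omega0 = omega_part t #|D0| by rewrite /omega0 cardD.
have -> : nu0 = nu_part t #|D0| by rewrite /nu0 cardD.
split.
  apply: induces_predT.
  under [X in dsum X _]eq_bigr => i _ do rewrite omegaE nuE.
  exact: (induces_petals t_gt0 k_gt1 D_cyclic D_cover D_meet).
under eq_bigr => i _ do rewrite nuE.
exact: (card_central_tree t_gt0 k_gt1 D_cyclic D_cover D_meet).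
Qed.
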